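(* Let $M$ be a matroid such that for all cyclic flats $A,B$ of $M$, the pair $(A,B)$ is modular and $A\cap B$ is a cyclic flat of $M$. Then $M$ is configuration unique.
   Context: A cyclic flat is a flat that is a (possibly empty) union of circuits; the cyclic flats of $M$ form a lattice $\mathcal{Z}(M)$ under inclusion. A pair $(X,Y)$ is modular if $r(X)+r(Y)=r(X\cup Y)+r(X\cap Y)$. Matroids $M,N$ have the same configuration if $|E(M)|=|E(N)|$ and there is a lattice isomorphism $\Phi:\mathcal{Z}(M)\to\mathcal{Z}(N)$ with $|\Phi(F)|=|F|$ and $r_N(\Phi(F))=r_M(F)$ for all $F$; $M$ is configuration unique if every matroid with the same configuration as $M$ is isomorphic to $M$. *)

(* Defs.v *)
From mathcomp Require Import all_boot.

Set Implicit Arguments.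
Unset Strict Implicit.
Unset Printing Implicit Defensive.

(* The ground set of a matroid is the whole finite type E. *)
Record matroid (E : finType) := Matroid {
  indep : pred {set E};
  indep0 : indep set0;
  indep_sub : forall I J : {set E}, I \subset J -> indep J -> indep I;
  indep_aug : forall I J : {set E}, indep I -> indep J -> #|I| < #|J| ->
    exists2 x, x \in J :\: I & indep (x |: I)
}.

Section MatroidNotions.
Variables (E : finType) (M : matroid E).
Implicit Types A B C F X : {set E}.

Definition rank X : nat := \max_(I : {set E} | (I \subset X) && indep M I) #|I|.

Definition circuit C : bool := minset [pred X | ~~ indep M X] C.

Definition flat F : bool :=
  [forall x, (x \notin F) ==> (rank F < rank (x |: F))].

Definition cyclic F : bool :=
  [exists S : {set {set E}}, (S \subset [set C | circuit C]) && (F == cover S)].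

Definition cyclic_flat F : bool := flat F && cyclic F.

Definition modular_pair A B : Prop :=
  rank A + rank B = rank (A :|: B) + rank (A :&: B).

Definition cyclic_flats : Type := {F : {set E} | cyclic_flat F}.

End MatroidNotions.

Definition isomorphic (E E' : finType) (M : matroid E) (N : matroid E') : Prop :=
  exists2 f : E -> E',
    bijective f & forall X : {set E}, indep N (f @: X) = indep M X.

(* The lattice structure on cyclic flats is the one determined by inclusion,
   so a lattice isomorphism is a bijection that preserves and reflects
   inclusion. *)
Definition same_configuration (E E' : finType)
    (M : matroid E) (N : matroid E') : Prop :=
  #|E| = #|E'| /\
  exists Phi : cyclic_flats M -> cyclic_flats N,
    [/\ bijective Phi,
        forall F G, (val (Phi F) \subset val (Phi G)) = (val F \subset val G),
        forall F, #|val (Phi F)| = #|val F|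
      & forall F, rank N (val (Phi F)) = rank M (val F)].

Definition configuration_unique (E : finType) (M : matroid E) : Prop :=
  forall (E' : finType) (N : matroid E'),
    same_configuration M N -> isomorphic M N.

(* Main.v *)
(** In a matroid [N] with the same configuration as [M], the rank function on
    joins of cyclic flats is forced, so submodularity bounds the rank of
    [Phi A :&: Phi B] by that of [Phi (A :&: B)]; as the latter is a flat, the
    two sets coincide.  Hence all intersections of cyclic flats have the same
    cardinalities in [M] and in [N], the atoms of the two Venn diagrams have the
    same cardinalities, and some bijection of the ground sets induces [Phi].
    It is an isomorphism because a set [X] is independent if and only if
    [#|X :&: F| <= rank F] for all cyclic flats [F]. *)

Require Import Defs.
From mathcomp Require Import all_boot perm.

Set Implicit Arguments.
Unset Strict Implicit.
Unset Printing Implicit Defensive.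

(** * Rank, closure and flats *)

Section Matroid.
Variables (E : finType) (M : matroid E).
Implicit Types (A B C F I J X Y : {set E}) (x : E).

Lemma leq_rank_indep I X : I \subset X -> indep M I -> #|I| <= rank M X.
Proof.
move=> IX iI; apply: (leq_bigmax_cond (F := fun J : {set E} => #|J|)).
by rewrite IX iI.
Qed.

Lemma basis_exists X :
  exists I, [/\ I \subset X, indep M I & #|I| = rank M X].
Proof.
have h : (set0 \subset X) && indep M set0 by rewrite sub0set indep0.
rewrite /rank (bigmax_eq_arg set0 h).
by case: arg_maxnP => // I /andP[IX iI] _; exists I.
Qed.

Lemma basis_extend I X : I \subset X -> indep M I ->
  exists J, [/\ I \subset J, J \subset X, indep M J & #|J| = rank M X].
Proof.
move=> IX iI.
have [J maxJ IJ] := @maxset_exists E (fun J => (J \subset X) && indep M J) I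
  (introT andP (conj IX iI)).
have /andP[JX iJ] := maxsetp maxJ.
exists J; split=> //; apply/eqP; rewrite eqn_leq leq_rank_indep //= leqNgt.
apply/negP; have [K [KX iK <-]] := basis_exists X => ltJK.
have [x /setDP[xK xJ] ixJ] := indep_aug iJ iK ltJK.
have eJ : x |: J = J.
  apply: (maxsetsup maxJ); last exact: subsetUr.
  by rewrite /= subUset sub1set (subsetP KX) // JX.
by rewrite -eJ setU11 in xJ.
Qed.

Lemma rankS X Y : X \subset Y -> rank M X <= rank M Y.
Proof.
move=> XY; have [I [IX iI <-]] := basis_exists X.
by apply: leq_rank_indep iI; apply: subset_trans XY.
Qed.

(** A basis [I] of [X :&: Y] extends to a basis [J] of [X :|: Y]. The traces of [J] on [X] and [Y]
    are independent, and their sizes add up to [#|J|] plus the size of a set containing [I]. *)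
Lemma rank_submod X Y :
  rank M (X :|: Y) + rank M (X :&: Y) <= rank M X + rank M Y.
Proof.
have [I [IXY iI <-]] := basis_exists (X :&: Y).
have IU : I \subset X :|: Y.
  by apply: subset_trans IXY (subset_trans (subsetIl _ _) (subsetUl _ _)).
have [J [IJ JU iJ <-]] := basis_extend IU iI.
have iJI Z : indep M (J :&: Z) by apply: indep_sub iJ; apply: subsetIl.
apply: leq_trans (leq_add (leq_rank_indep (subsetIr J X) (iJI X))
                          (leq_rank_indep (subsetIr J Y) (iJI Y))).
rewrite -[leqRHS]cardsUI -setIUr -setIIr (setIidPl JU) leq_add2l.
by apply: subset_leq_card; rewrite subsetI IJ.
Qed.

Lemma rank_ltn_card X : ~~ indep M X -> rank M X < #|X|.
Proof.
have [I [IX iI <-]] := basis_exists X => dX.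
rewrite ltn_neqAle subset_leq_card // andbT; apply: contra dX => /eqP eIX.
suff -> : X = I by [].
by apply/esym/eqP; rewrite eqEcard IX eIX leqnn.
Qed.

Definition closure X := [set x | rank M (x |: X) <= rank M X].

Lemma subset_closure X : X \subset closure X.
Proof. by apply/subsetP=> x xX; rewrite inE (setUidPr _) ?sub1set. Qed.

(** Were the rank larger, a basis of [X] could be augmented by some [x] of the closure, which would
    then raise the rank of [X]. *)
Lemma rank_closure X : rank M (closure X) = rank M X.
Proof.
apply/eqP; rewrite eqn_leq (rankS (subset_closure X)) andbT leqNgt.
have [I [IX iI eI]] := basis_exists X.
have [J [JX iJ eJ]] := basis_exists (closure X).
rewrite -eI -eJ; apply/negP=> /(indep_aug iI iJ)[x /setDP[xJ xI] ixI].
have := subsetP JX x xJ; rewrite inE leqNgt => /negP; apply.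
have := leq_rank_indep (setUS [set x] IX) ixI.
by rewrite cardsU1 xI add1n eI.
Qed.

Lemma flat_closure X : flat M (closure X).
Proof.
apply/forallP=> x; apply/implyP; rewrite inE -ltnNge rank_closure => ltr.
by apply: leq_trans ltr _; apply/rankS/setUS/subset_closure.
Qed.

Lemma flat_sub_rank F X :
  flat M F -> F \subset X -> rank M X <= rank M F -> X \subset F.
Proof.
move=> /forallP flF FX leXF; apply/subsetP=> x xX.
apply: contraLR (leXF) => xF; rewrite -ltnNge.
apply: leq_trans (implyP (flF x) xF) _.
by apply: rankS; rewrite subUset sub1set xX.
Qed.

(** * Cyclic sets and cyclic flats *)

Lemma cyclicP F :
  reflect (forall x, x \in F -> exists2 C, circuit M C & x \in C /\ C \subset F)
          (cyclic M F).
Proof.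
apply: (iffP existsP) => [[S /andP[/subsetP SC /eqP ->]] x | FC].
  case/bigcupP=> C CS xC; exists C; first by have := SC C CS; rewrite inE.
  by split=> //; apply: bigcup_sup.
exists [set C | circuit M C && (C \subset F)]; apply/andP; split.
  by apply/subsetP=> C; rewrite !inE => /andP[].
rewrite eqEsubset; apply/andP; split.
  apply/subsetP=> x /FC[C cC [xC CF]].
  by apply/bigcupP; exists C => //; rewrite inE cC.
by apply/bigcupsP=> C; rewrite inE => /andP[].
Qed.

Lemma circuit_exists X :
  ~~ indep M X -> exists2 C, circuit M C & C \subset X.
Proof.
move=> dX; have [C] := @minset_exists E [pred Y : {set E} | ~~ indep M Y] X dX.
by exists C.
Qed.

Lemma circuit_dep C : circuit M C -> ~~ indep M C.
Proof. exact: minsetp. Qed.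

Lemma cyclic_circuit C : circuit M C -> cyclic M C.
Proof. by move=> cC; apply/cyclicP=> x xC; exists C. Qed.

Lemma cyclicU A B : cyclic M A -> cyclic M B -> cyclic M (A :|: B).
Proof.
move=> /cyclicP cA /cyclicP cB; apply/cyclicP=> x /setUP[/cA|/cB] [C cC [xC CF]].
  by exists C => //; split=> //; apply: subset_trans (subsetUl _ _).
by exists C => //; split=> //; apply: subset_trans (subsetUr _ _).
Qed.

(** For a basis [I] of [X] and a point [x] of the closure outside [X], the set [x |: I] is
    dependent; any circuit in it contains [x], since [I] is independent. *)
Lemma cyclic_closure X : cyclic M X -> cyclic M (closure X).
Proof.
move=> /cyclicP cX; apply/cyclicP=> x xcl.
have [xX | xX] := boolP (x \in X).
  have [C cC [xC CX]] := cX x xX; exists C => //; split=> //.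
  exact: subset_trans CX (subset_closure X).
have [I [IX iI eI]] := basis_exists X.
have dxI : ~~ indep M (x |: I).
  apply/negP=> ixI; have := leq_rank_indep (setUS [set x] IX) ixI.
  rewrite cardsU1 (contra (subsetP IX x) xX) add1n eI leqNgt ltnS.
  by rewrite inE in xcl; rewrite xcl.
have [C cC CxI] := circuit_exists dxI; exists C => //; split.
  apply: contraLR (circuit_dep cC) => xC; rewrite negbK.
  apply: indep_sub iI; apply/subsetP=> y yC.
  have := subsetP CxI y yC; rewrite !inE => /predU1P[eyx|//].
  by rewrite -eyx yC in xC.
apply: subset_trans CxI _; rewrite subUset sub1set xcl.
exact: subset_trans IX (subset_closure X).
Qed.

Lemma cyclic_flat_closure X : cyclic M X -> cyclic_flat M (closure X).
Proof. by move=> cX; rewrite /cyclic_flat flat_closure cyclic_closure. Qed.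

Lemma cyclic_flat_closureU A B : cyclic_flat M A -> cyclic_flat M B ->
  cyclic_flat M (closure (A :|: B)).
Proof.
by move=> /andP[_ cA] /andP[_ cB]; apply/cyclic_flat_closure/cyclicU.
Qed.

(** A dependent set contains a circuit [C], and the closure of [C] is a cyclic flat of rank less
    than [#|C|], which violates the bound. *)
Lemma indep_cyclic_flatP X :
  reflect (forall F, cyclic_flat M F -> #|X :&: F| <= rank M F) (indep M X).
Proof.
apply: (iffP idP) => [iX F _ | hX].
  by apply: leq_rank_indep (subsetIr _ _) (indep_sub (subsetIl _ _) iX).
apply: contraT => /circuit_exists[C cC CX].
have := hX _ (cyclic_flat_closure (cyclic_circuit cC)).
rewrite rank_closure leqNgt.
rewrite (leq_trans (rank_ltn_card (circuit_dep cC))) //.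
by apply: subset_leq_card; rewrite subsetI CX subset_closure.
Qed.

End Matroid.

(** * Bijections from matching counts *)

(** Equal fibers make the lists of values of [g] and [g'] permutations of each other; the
    permutation of positions gives [f]. *)
Lemma fiber_bijection (T T' : finType) (K : eqType) (g : T -> K) (g' : T' -> K) :
  (forall k, #|[pred x | g x == k]| = #|[pred y | g' y == k]|) ->
  exists2 f : T -> T', bijective f & forall x, g' (f x) = g x.
Proof.
move=> eqgg'; have cardfE (U : finType) (h : U -> K) k :
    count_mem k (map h (enum U)) = #|[pred x | h x == k]|.
  rewrite count_map cardE -size_filter /enum_mem -filter_predI; congr size.
  by apply: eq_filter => x; rewrite !inE /= andbT.
have pgg' : perm_eq (map g (enum T)) (map g' (enum T')).
  by apply/allP=> k _ /=; rewrite !cardfE eqgg'.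
have eT : #|T| = #|T'|.
  by rewrite !cardE -(size_map g) -(size_map g') (perm_size pgg').
have /tuple_permP[p eg] : perm_eq (map g (enum T)) (map_tuple g' (enum_tuple T')).
  exact: pgg'.
pose f x := enum_val (p (cast_ord eT (enum_rank x))).
exists f => [|x].
  apply: inj_card_bij; last by rewrite eT.
  by move=> x y /enum_val_inj/perm_inj/cast_ord_inj/enum_rank_inj.
have := congr1 (fun s => nth (g x) s (enum_rank x)) eg.
rewrite (nth_map x) -?cardE ?ltn_ord // nth_enum_rank => eg_x.
rewrite [RHS]eg_x -[X in nth _ _ X]/(val (cast_ord eT (enum_rank x))) -tnth_nth.
by rewrite tnth_mktuple tnth_map (tnth_nth (f x)) -enum_val_nth.
Qed.

(** The atoms of the two Venn diagrams are the fibers of [key]; their sizes are recovered from those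
    of the intersections by inclusion-exclusion, done as a recursion. *)
Lemma venn_bijection (I T T' : finType) (A : I -> {set T}) (B : I -> {set T'}) :
  (forall J : {set I}, #|\bigcap_(i in J) A i| = #|\bigcap_(i in J) B i|) ->
  exists2 f : T -> T', bijective f & forall x i, (f x \in B i) = (x \in A i).
Proof.
move=> cardAB.
pose key (U : finType) (S : I -> {set U}) x := [set i | x \in S i].
have cap_sum (U : finType) (S : I -> {set U}) (J : {set I}) :
    #|\bigcap_(i in J) S i| =
    #|[pred x | key U S x == J]| +
    \sum_(K : {set I} | J \proper K) #|[pred x | key U S x == K]|.
  have -> : #|\bigcap_(i in J) S i| = \sum_(x | J \subset key U S x) 1.
    rewrite sum1_card; apply: eq_card => x; rewrite unfold_in.
    apply/bigcapP/subsetP => h i iJ; first by rewrite inE h.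
    by have := h i iJ; rewrite inE.
  rewrite (partition_big (key U S) (fun K : {set I} => J \subset K)) //=.
  rewrite (bigD1 J) //=; congr (_ + _).
    rewrite sum1_card; apply: eq_card => x; rewrite !inE unfold_in.
    by case: eqP => [->|]; rewrite ?subxx ?andbF.
  apply: eq_big => [K | K /andP[JK _]]; first by rewrite properEneq eq_sym andbC.
  rewrite sum1_card; apply: eq_card => x; rewrite !inE unfold_in.
  by case: eqP => [->|]; rewrite ?JK ?andbF.
have [J | f bijf keyf] := @fiber_bijection T T' _ (key T A) (key T' B).
  (* Descending induction on [J]: in [cap_sum], the atoms of all strictly larger index sets are
     already known to match. *)
  have [n] := ubnP (#|I| - #|J|); elim: n J => // n IHn J ltJn.
  apply/eqP; rewrite -(eqn_add2r
    (\sum_(K : {set I} | J \proper K) #|[pred x | key T A x == K]|)).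
  rewrite -cap_sum cardAB cap_sum; apply/eqP; congr (_ + _).
  apply: eq_bigr => K ltJK; apply/esym/IHn.
  apply: (leq_trans _ (ltnSE ltJn)); have ltcJK := proper_card ltJK.
  by rewrite ltn_sub2l // (leq_trans ltcJK) ?max_card.
exists f => // x i; have /setP/(_ i) := keyf x.
by rewrite !inE.
Qed.

Theorem theorem6p1 (E : finType) (M : matroid E)
  (hM : forall A B : {set E}, cyclic_flat M A -> cyclic_flat M B ->
    modular_pair M A B /\ cyclic_flat M (A :&: B)) :
  configuration_unique M.
Proof.
move=> E' N [cardE [Phi [[Psi PhiK PsiK] subPhi cardPhi rankPhi]]].
pose I : finType := {F : {set E} | cyclic_flat M F}.
pose A (F : I) : {set E} := val F.
pose B (F : I) : {set E'} := val (Phi F).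
have capAB (F G : I) : exists2 H : I, A H = A F :&: A G & B H = B F :&: B G.
  have [modFG cflFG] := hM _ _ (valP F) (valP G).
  pose H : I := Sub (A F :&: A G) cflFG; exists H => //.
  have HF : B H \subset B F by rewrite subPhi subsetIl.
  have HG : B H \subset B G by rewrite subPhi subsetIr.
  have HFG : B H \subset B F :&: B G by rewrite subsetI HF.
  (* As [B H] is a flat, it remains to bound the rank of [B F :&: B G] by that of [B H]. *)
  apply/eqP; rewrite eqEsubset HFG; apply: (flat_sub_rank (M := N)) => //.
    by have /andP[] := valP (Phi H).
  (* [D] corresponds to the join of [B F] and [B G]. It contains [A F :|: A G], so the rank of
     [B F :|: B G] in [N] is at least that of [A F :|: A G] in [M]; modularity in [M] and
     submodularity in [N] then give the bound. *)
  pose D : I := Psi (Sub (closure N (B F :|: B G))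
    (cyclic_flat_closureU (valP (Phi F)) (valP (Phi G)))).
  have eD : B D = closure N (B F :|: B G) by rewrite /B PsiK.
  have FGD : A F :|: A G \subset A D.
    have UD := subset_closure N (B F :|: B G).
    rewrite subUset -!subPhi -/(B D) -/(B F) -/(B G) eD.
    by rewrite !(subset_trans _ UD) ?subsetUl ?subsetUr.
  have := rank_submod N (B F) (B G).
  rewrite -(rank_closure N (B F :|: B G)) -eD !rankPhi modFG -/(A D) => le1.
  rewrite -(leq_add2l (rank M (A F :|: A G))).
  by apply: leq_trans le1; rewrite leq_add2r rankS.
have cap_card (J : {set I}) :
    #|\bigcap_(F in J) A F| = #|\bigcap_(F in J) B F|.
  (* The first alternative serves the empty intersection, as the ground set need not be a cyclic
     flat; there [cardE] gives the equality. *)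
  suff [[-> ->]|[H -> ->]] : (\bigcap_(F in J) A F = setT /\
      \bigcap_(F in J) B F = setT) \/
      exists2 H, \bigcap_(F in J) A F = A H & \bigcap_(F in J) B F = B H.
  - by rewrite !cardsT.
  - by rewrite cardPhi.
  apply: (big_ind2 (fun X Y => (X = setT /\ Y = setT) \/
    exists2 H, X = A H & Y = B H)); first by left.
    move=> X1 Y1 X2 Y2 [[-> ->]|[F -> ->]]; first by rewrite !setTI.
    case=> [[-> ->]|[G -> ->]]; right; first by exists F; rewrite setIT.
    by have [H eA eB] := capAB F G; exists H.
  by move=> F _; right; exists F.
have [f bijf fAB] := venn_bijection cap_card.
exists f => // X.
have injf := bij_inj bijf.
have card_cap (F : I) : #|f @: X :&: B F| = #|X :&: A F|.
  rewrite -(card_imset (X :&: A F) injf); apply: eq_card => y.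
  apply/setIP/imsetP => [[/imsetP[x xX ->]] | [x /setIP[xX xF] ->]].
    by rewrite fAB => xF; exists x => //; apply/setIP.
  by rewrite fAB imset_f.
apply/indep_cyclic_flatP/indep_cyclic_flatP => h F cF.
  pose F' : I := Sub F cF.
  by have := h _ (valP (Phi F')); rewrite card_cap rankPhi.
(* Every cyclic flat of [N] is some [B F'], so the bounds for [M] cover all those needed in [N]. *)
pose F' : I := Psi (Sub F cF).
have eF : F = B F' by rewrite /B PsiK.
by rewrite eF card_cap rankPhi; apply: h; apply: (valP F').
Qed.
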